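(* Let $R$ be an almost perfect domain with field of quotients $Q\neq R$. An $R$-module $M$ is injective if and only if $M$ is divisible and $\mathrm{i.d.}_R(M)\le 1$; that is, $\mathcal{IN}=\mathcal{DI}\cap\mathcal{I}_1$.
   Context: All rings are commutative with $1\neq 0$ and all modules are unital. A ring is perfect if every module over it has a projective cover. An almost perfect domain is an integral domain $R$ such that $R/I$ is perfect for every non-zero proper ideal $I$. $M$ is divisible if $rM=M$ for every $0\neq r\in R$. $\mathrm{i.d.}_R(M)$ is the injective dimension of $M$. $\mathcal{IN}$, $\mathcal{DI}$ and $\mathcal{I}_1$ denote the classes of $R$-modules that are, respectively, injective, divisible, and of injective dimension at most $1$. *)

(* Defs.v *)
From HB Require Import structures.
From mathcomp Require Import all_boot all_order all_algebra.

Set Implicit Arguments.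
Unset Strict Implicit.
Unset Printing Implicit Defensive.

Import GRing.Theory.
Local Open Scope ring_scope.

(* Submodules ({pred M} with submod_closed) and ideals (idealr) are boolean
   predicates, as everywhere in MathComp. Reasoning is meant to be classical
   (mathcomp.classical.boolp), so these are all submodules and all ideals, and
   choiceType structures are available on every carrier. *)

Section Modules.
Variable R : comNzRingType.

Definition surjective_map (A B : Type) (f : A -> B) : Prop :=
  forall b, exists a, f a = b.

Definition injective_module (M : lmodType R) : Prop :=
  forall (A B : lmodType R) (i : {linear A -> B}) (f : {linear A -> M}),
    injective i -> exists g : {linear B -> M}, forall a, g (i a) = f a.

Definition projective_module (P : lmodType R) : Prop :=
  forall (A B : lmodType R) (p : {linear A -> B}) (f : {linear P -> B}),
    surjective_map p -> exists g : {linear P -> A}, forall x, p (g x) = f x.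

(* K is superfluous in M: K + N = M implies N = M for every submodule N. *)
Definition superfluous (M : lmodType R) (K : {pred M}) : Prop :=
  forall N : {pred M}, submod_closed N ->
    (forall x, exists k n, [/\ k \in K, n \in N & x = k + n]) ->
    forall x, x \in N.

Definition is_projective_cover (P M : lmodType R) (f : {linear P -> M}) : Prop :=
  [/\ projective_module P, surjective_map f
    & superfluous [pred x : P | f x == 0]].

Definition perfect_ring : Prop :=
  forall M : lmodType R,
    exists (P : lmodType R) (f : {linear P -> M}), is_projective_cover f.

Definition divisible (M : lmodType R) : Prop :=
  forall r : R, r != 0 -> forall m : M, exists m' : M, r *: m' = m.

(* i.d.(M) <= n: there is an injective resolution
   0 -> M -> E 0 -> E 1 -> ... with E i = 0 for all i > n. *)
Definition injdim_le (n : nat) (M : lmodType R) : Prop :=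
  exists (E : nat -> lmodType R) (e : {linear M -> E 0%N})
         (d : forall i, {linear E i -> E i.+1}),
    [/\ forall i, injective_module (E i),
        injective e,
        forall x : E 0%N, d 0%N x = 0 <-> exists m, e m = x,
        forall i (x : E i.+1), d i.+1 x = 0 <-> exists y, d i y = x
      & forall i, (n < i)%N -> forall x : E i, x = 0].

End Modules.

Arguments perfect_ring R : clear implicits.

(* Elements of idealr R are proper ideals (1 \notin I). *)
Definition almost_perfect (R : idomainType) : Prop :=
  forall I : idealr R, (exists2 r : R, r \in I & r != 0) ->
    perfect_ring {ideal_quot I}.

(* Main.v *)
Require Import Defs.
From HB Require Import structures.
From mathcomp Require Import all_boot all_order all_algebra.
From mathcomp Require Import boolp classical_sets.

Set Implicit Arguments.
Unset Strict Implicit.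
Unset Printing Implicit Defensive.

Import GRing.Theory.
Local Open Scope ring_scope.

(** Injective modules over a domain are divisible and are their own injective
    resolution, so the content is the converse. Let [M] be divisible with an
    injective resolution [0 -> M -> E0 -> E1 -> 0].

    Divisibility means that [Ext^1(R/rR, M) = 0] for every nonzero [r]. Since
    [Ext^2(-, M) = 0], the functor [Ext^1(-, M)] turns injections into
    surjections, so it also vanishes on every submodule of [R/rR]. Perfectness
    supplies such submodules: if a maximal ideal [P] contains a nonzero ideal
    [I], then [R/P] embeds in [R/I] ([almost_perfect_socle]). With [I = rR] this
    gives [Ext^1(R/P, M) = 0] for every nonzero maximal [P], that is, every
    linear map [P -> M] extends to [R] ([injective_of_resolution]). With
    arbitrary [I] it says that every nonzero cyclic torsion module has a simple
    submodule, so a maximal partial linear map into [M] that was not total could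
    be extended by an element killed modulo its domain by exactly a maximal
    ideal; hence [M] is injective ([injective_of_maximal_ideals]).

    It remains to find, in a perfect ring [S] with a maximal ideal [P], a
    nonzero [s] such that [s P = 0] ([perfect_socle]). The cover of [S/P]
    produces an element [e] outside [P] on whose multiples everything outside
    [P] acts invertibly ([local_element]), so that [S e] is a local ring. The
    cover of a direct limit of copies of [S] shows, by Bass's argument, that
    products of elements of [P] are eventually killed by an element congruent
    to [1] modulo [P] ([product_annihilated]). Were no [s] to exist,
    multiplying [e] by well chosen elements of [P] would give products that
    never vanish, and these two facts would contradict each other. *)

(** * Submodules and quotient modules *)

Lemma linear_exists (R : pzRingType) (U V : lmodType R) (f : U -> V) :
  linear f -> exists g : {linear U -> V}, forall x, g x = f x.
Proof.
move=> lf; pose g : {linear U -> V} :=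
  HB.pack f (GRing.isLinear.Build R U V *:%R f lf).
by exists g.
Qed.

Section Submodules.
Variables (R : comNzRingType) (M : lmodType R).

Definition is_submodule (N : M -> Prop) : Prop :=
  N 0 /\ forall a x y, N x -> N y -> N (a *: x + y).

Variables (N : M -> Prop) (subN : is_submodule N).

Lemma submoduleZ a x : N x -> N (a *: x).
Proof. by case: subN => N0 NP Nx; rewrite -[_ *: _]addr0; apply: NP. Qed.

Lemma submoduleD x y : N x -> N y -> N (x + y).
Proof. by case: subN => _ NP Nx Ny; rewrite -[x]scale1r; apply: NP. Qed.

Lemma submoduleN x : N x -> N (- x).
Proof. by rewrite -scaleN1r; apply: submoduleZ. Qed.

Lemma submoduleB x y : N x -> N y -> N (x - y).
Proof. by move=> Nx Ny; apply: submoduleD => //; apply: submoduleN. Qed.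

Lemma submodule_sum (I : Type) (r : seq I) (Q : pred I) (F : I -> M) :
  (forall i, Q i -> N (F i)) -> N (\sum_(i <- r | Q i) F i).
Proof. by move=> NF; elim/big_ind: _ => //; [case: subN | apply: submoduleD]. Qed.

(** The Boolean form of a submodule, with its proof as a phantom argument so
    that the closure instances can be attached to it. *)
Definition submodule_pred & is_submodule N : {pred M} := fun x => `[< N x >].

Lemma submodule_predP x : reflect (N x) (x \in submodule_pred subN).
Proof. exact: asboolP. Qed.

Lemma submodule_pred_closed : submod_closed (submodule_pred subN).
Proof.
split; first by apply/submodule_predP; case: subN.
by move=> a x y /submodule_predP Nx /submodule_predP Ny;
  apply/submodule_predP; case: subN => _; apply.
Qed.

HB.instance Definition _ :=
  GRing.isSubmodClosed.Build R M (submodule_pred subN) submodule_pred_closed.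

Definition submodule_type := {x : M | x \in submodule_pred subN}.
HB.instance Definition _ := SubChoice.on submodule_type.
HB.instance Definition _ := [SubChoice_isSubLmodule of submodule_type by <:].

Lemma submodule_exists :
  exists (A : lmodType R) (i : {linear A -> M}),
    injective i /\ forall x, N x <-> exists a, i a = x.
Proof.
exists submodule_type, (val : {linear submodule_type -> M}).
split; first exact: val_inj.
move=> x; split=> [Nx | [a <-]]; last exact/submodule_predP/(valP a).
by exists (exist _ x (introT (submodule_predP x) Nx)).
Qed.

Definition quotient_module := {ideal_quot (submodule_pred subN)}.
HB.instance Definition _ := GRing.Zmodule.on quotient_module.
HB.instance Definition _ := ZmodQuotient.on quotient_module.

Local Open Scope quotient_scope.

Lemma quotient_eqP (x y : M) :
  \pi_quotient_module x = \pi_quotient_module y <-> N (x - y).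
Proof.
have E := Quotient.idealrBE (submodule_pred subN) x y.
split=> [/eqP|Nxy]; first by rewrite -E => /submodule_predP.
by apply/eqP; rewrite -E; apply/submodule_predP.
Qed.

Definition quotient_scale a (u : quotient_module) : quotient_module :=
  \pi_quotient_module (a *: repr u).

Lemma pi_scale a x :
  \pi_quotient_module (a *: x) = quotient_scale a (\pi_quotient_module x).
Proof.
apply/quotient_eqP; rewrite -scalerBr; apply: submoduleZ.
by apply/quotient_eqP; rewrite reprK.
Qed.

Lemma quotient_scaleA a b u :
  quotient_scale a (quotient_scale b u) = quotient_scale (a * b) u.
Proof. by elim/quotW: u => x; rewrite -(pi_scale b x) -!pi_scale scalerA. Qed.
Lemma quotient_scale1 : left_id 1 quotient_scale.
Proof. by elim/quotW=> x; rewrite -pi_scale scale1r. Qed.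
Lemma quotient_scaleDr : right_distributive quotient_scale +%R.
Proof.
move=> a; elim/quotW=> x; elim/quotW=> y.
by rewrite -raddfD /= -!pi_scale scalerDr raddfD.
Qed.
Lemma quotient_scaleDl u : {morph quotient_scale^~ u : a b / a + b}.
Proof. by elim/quotW: u => x a b; rewrite -!pi_scale scalerDl raddfD. Qed.

HB.instance Definition _ := GRing.Zmodule_isLmodule.Build R quotient_module
  quotient_scaleA quotient_scale1 quotient_scaleDr quotient_scaleDl.

Lemma pi_linear : linear (\pi_quotient_module : M -> quotient_module).
Proof. by move=> a x y; rewrite raddfD /= pi_scale. Qed.

Lemma quotient_exists :
  exists (L : lmodType R) (q : {linear M -> L}),
    surjective_map q /\ forall x, q x = 0 <-> N x.
Proof.
have [q qE] := linear_exists pi_linear.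
exists quotient_module, q; split=> [u | x].
  by exists (repr u); rewrite qE; apply: reprK.
rewrite -(linear0 q) !qE; split=> [/quotient_eqP | Nx]; first by rewrite subr0.
by apply/quotient_eqP; rewrite subr0.
Qed.

End Submodules.

(** * Projective covers *)
Section Covers.
Variable S : comNzRingType.

(** How superfluousness is used throughout: a submodule that meets every fibre
    of the cover is everything. *)
Lemma superfluousP (X Y : lmodType S) (f : {linear X -> Y}) (N : X -> Prop) :
  superfluous [pred x : X | f x == 0] -> is_submodule N ->
  (forall y, exists2 n, N n & f n = f y) -> forall y, N y.
Proof.
move=> supf subN NE y; apply/(submodule_predP subN); apply: supf.
  exact: submodule_pred_closed.
move=> z; have [n Nn fn] := NE z; exists (z - n), n; split.
- by rewrite inE linearB /= fn subrr.
- exact/submodule_predP.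
- by rewrite subrK.
Qed.

(** A cover of [L] is a direct summand of any projective module mapping onto
    [L]: the lift [k] is surjective because its image meets every fibre of the
    cover, and [h] splits it because the cover is projective. So [F]
    can be chosen to suit [L], and need not be free on the elements of [X]. *)
Lemma cover_split (F X L : lmodType S) (p : {linear F -> L})
    (f : {linear X -> L}) :
  projective_module F -> surjective_map p -> is_projective_cover f ->
  exists (k : {linear F -> X}) (h : {linear X -> F}),
    (forall q, f (k q) = p q) /\ (forall x, k (h x) = x).
Proof.
move=> projF surjp [projX surjf supf].
have [k fk] := projF _ _ f p surjf.
have surjk : forall x, exists q, k q = x.
  apply: (superfluousP supf).
    split; first by exists 0; rewrite linear0.
    by move=> a _ _ [q <-] [r <-]; exists (a *: q + r); rewrite linearP.
  move=> y; have [q pq] := surjp (f y).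
  by exists (k q); [exists q | rewrite fk].
have [h kh] := projX _ _ k (idfun : {linear X -> X}) surjk.
by exists k, h.
Qed.

Lemma projective_regular : projective_module S^o.
Proof.
move=> A B p f surjp; have [a pa] := surjp (f (1 : S^o)).
have [|g gE] := @linear_exists _ S^o A (fun s : S => s *: a).
  by move=> s t u /=; rewrite scalerDl -scalerA.
by exists g => x; rewrite gE linearZ /= pa -linearZ /= /GRing.scale /= mulr1.
Qed.

(** As a module, [{poly S}] is free with basis the powers of ['X]; this is the
    countable free module of Bass's argument. *)
Lemma projective_poly : projective_module {poly S}.
Proof.
move=> A B p f surjp.
have [a pa] := choice (fun n => surjp (f ('X^n : {poly S}))).
pose g0 (q : {poly S}) := \sum_(i < size q) q`_i *: a i.
have g0E n (q : {poly S}) : (size q <= n)%N -> g0 q = \sum_(i < n) q`_i *: a i.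
  move=> le_qn; rewrite /g0 (big_ord_widen _ (fun i => q`_i *: a i) le_qn).
  rewrite big_mkcond; apply: eq_bigr => i _; case: ltnP => // /(nth_default 0) ->.
  by rewrite scale0r.
have [|g gE] := @linear_exists _ {poly S} A g0.
  move=> c q r; pose n := maxn (size (c *: q + r)) (maxn (size q) (size r)).
  rewrite !(@g0E n) ?leq_max ?leqnn ?orbT //.
  rewrite scaler_sumr -big_split /=; apply: eq_bigr => i _.
  by rewrite coefD coefZ scalerDl scalerA.
exists g => q; rewrite gE linear_sum -[in RHS](coefK q) poly_def linear_sum /=.
by apply: eq_bigr => i _; rewrite !linearZ /= pa.
Qed.

End Covers.

(** * Simple submodules of perfect rings *)
Section Socle.
Variables (S : comNzRingType) (P : S -> Prop).
Hypothesis idealP : is_submodule (P : S^o -> Prop).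

Lemma ideal_mull a x : P x -> P (a * x).
Proof. exact: (submoduleZ idealP). Qed.
Lemma ideal_mulr a x : P x -> P (x * a).
Proof. by rewrite mulrC; apply: ideal_mull. Qed.

Lemma det_congr1 n (A : 'M[S]_n) :
  (forall i j, P (A i j)) -> P (1 - \det (1%:M - A)).
Proof.
move=> PA; rewrite -[X in X - _](det1 S n) /determinant -sumrB.
apply: (submodule_sum idealP) => s _; rewrite -mulrBr; apply: ideal_mull.
apply: (big_ind2 (fun x y => P (x - y))) => [|x1 x2 y1 y2 Px Py|i _].
- by rewrite subrr; case: idealP.
- have -> : x1 * y1 - x2 * y2 = y1 * (x1 - x2) + x2 * (y1 - y2).
    by rewrite !mulrBr addrA mulrC (mulrC y1 x2) subrK.
  by apply: (submoduleD idealP); apply: ideal_mull.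
- by rewrite !mxE opprB addrC subrK.
Qed.

(** The determinant trick: [\det (1 - A)] kills [v], and it is congruent to
    [1] modulo the ideal. *)
Lemma nakayama n (v : 'rV[S]_n) (A : 'M[S]_n) :
  (forall i j, P (A i j)) -> v = v *m A -> exists2 d, P (1 - d) & d *: v = 0.
Proof.
move=> PA vE; exists (\det (1%:M - A)); first exact: det_congr1.
have: v *m (1%:M - A) *m \adj (1%:M - A) = 0.
  by rewrite mulmxBr mulmx1 -vE subrr mul0mx.
by rewrite -mulmxA mul_mx_adj mul_mx_scalar.
Qed.

Hypothesis perfS : perfect_ring S.

(** Bass's T-nilpotence, in a form valid for any ideal [P]. The module [L] is
    the direct limit of [S -> S -> ...] along multiplications by the [a n],
    presented as the cokernel of [1 - b] on [{poly S}], where [b] sends ['X^n]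
    to [a n *: 'X^n.+1]. Since [L = P L], superfluousness forces the cover [X]
    to satisfy [X = P X]; as [X] is a summand of [{poly S}], the determinant
    trick gives some [d] congruent to [1] that kills a lift of the class of
    [1]. So [d] is zero in the limit, which says that [d] times a finite
    product vanishes. *)
Lemma product_annihilated (a : nat -> S) : (forall n, P (a n)) ->
  exists n d, P (1 - d) /\ d * \prod_(i < n) a i = 0.
Proof.
move=> Pa.
pose b0 (q : {poly S}) : {poly S} :=
  \poly_(i < (size q).+1) (if i is j.+1 then a j * q`_j else 0).
have b0E q i : (b0 q)`_i = if i is j.+1 then a j * q`_j else 0.
  rewrite coef_poly ltnS; case: leqP => // lt_qi.
  by case: i lt_qi => // i; rewrite ltnS => /(nth_default 0) ->; rewrite mulr0.
have [|b bE] := @linear_exists _ {poly S} {poly S} b0.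
  move=> c q r; apply/polyP => i; rewrite coefD coefZ !b0E.
  by case: i => [|i]; rewrite ?mulr0 ?addr0 // coefD coefZ mulrDr mulrCA.
have {}bE q i : (b q)`_i = if i is j.+1 then a j * q`_j else 0 by rewrite bE b0E.
have Pb q i : P (b q)`_i.
  by rewrite bE; case: i => [|i]; [case: idealP | apply: ideal_mulr].
have [|L [p [surjp kerp]]] :=
    @quotient_exists S {poly S} (fun q => exists r, q = r - b r).
  split; first by exists 0; rewrite linear0 subr0.
  move=> c _ _ [q ->] [r ->]; exists (c *: q + r).
  by rewrite linearP scalerBr opprD addrACA.
have pb q : p (b q) = p q.
  apply/eqP; rewrite eq_sym -subr_eq0 -linearB /=; apply/eqP/kerp.
  by exists q.
have [X [f covf]] := perfS L.
have [k [h [fk kh]]] := cover_split (@projective_poly S) surjp covf.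
(* X = P X: the class f y = p q is also that of b q, whose lift k (b q) has
   coordinates in P. *)
have PN (y : X) : forall i, P (h y)`_i.
  case: covf => _ _ supf; move: y; apply: (superfluousP supf) => [|y].
    split=> [i|c x y Px Py i]; first by rewrite linear0 coef0; case: idealP.
    by rewrite linearP coefD coefZ; case: idealP => _; apply.
  have [q pq] := surjp (f y); exists (k (b q)); last by rewrite fk pb.
  move=> i; rewrite -[b q]coefK poly_def !linear_sum coef_sum.
  apply: (submodule_sum idealP) => j _.
  by rewrite !linearZ /= coefZ; apply: ideal_mulr.
pose q := h (k (1 : {poly S})).
pose A := \matrix_(i < size q, j < size q) (h (k 'X^i))`_j.
pose v := \row_(j < size q) q`_j.
have [||d Pd dv] := @nakayama _ v A.
- by move=> i j; rewrite mxE.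
- apply/rowP => j; rewrite !mxE.
  transitivity (h (k q))`_j; first by rewrite /q kh.
  rewrite -[X in h (k X)]coefK poly_def !linear_sum coef_sum.
  by apply: eq_bigr => i _; rewrite !linearZ /= coefZ !mxE.
have dq : d *: q = 0.
  apply/polyP => i; rewrite coefZ coef0; case: (ltnP i (size q)) => [lt_iq|].
    by move/rowP/(_ (Ordinal lt_iq)): dv; rewrite !mxE.
  by move/(nth_default 0) => ->; rewrite mulr0.
have /kerp[r rE] : p (d *: 1) = 0.
  by rewrite -fk linearZ /= -(kh (k 1)) -linearZ /= -/q dq !linear0.
exists (size r), d; split=> //.
(* The coefficients of d = r - b r give r`_0 = d and r`_n.+1 = a n * r`_n. *)
have rn n : r`_n = d * \prod_(i < n) a i.
  elim: n => [|n IHn].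
    move/polyP/(_ 0%N): rE; rewrite coefZ coefB bE coef1 /= subr0 => <-.
    by rewrite big_ord0.
  move/polyP/(_ n.+1): rE; rewrite coefZ coefB bE coef1 /= mulr0 => /esym/eqP.
  by rewrite subr_eq0 => /eqP ->; rewrite IHn big_ord_recr /= mulrCA (mulrC (a n)).
by rewrite -rn nth_default.
Qed.

Hypothesis P1 : ~ P 1.
Hypothesis maxP : forall t, ~ P t -> exists c, P (1 - c * t).

(** A cover of the simple module [S / P] is a cyclic summand of [S], generated
    by an idempotent [e] such that [S e] is a local ring: an element outside
    [P] acts invertibly on it. *)
Lemma local_element :
  exists2 e, ~ P e & forall t, ~ P t -> exists c, e = c * t * e.
Proof.
have [L [p [surjp kerp]]] := quotient_exists idealP.
have [X [f covf]] := perfS L.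
have [k [h [fk kh]]] := cover_split (@projective_regular S) surjp covf.
have kE (s : S) : k s = s *: k (1 : S^o).
  by rewrite -linearZ /= /GRing.scale /= mulr1.
have hZ (s : S) x : h (s *: x) = s * h x by rewrite linearZ.
exists (h (k (1 : S^o)) : S) => [Pe | t nPt].
  apply: P1; apply/kerp; rewrite -fk -(kh (k _)) fk.
  exact/kerp.
have genX (y : X) : exists s : S, y = (s * t) *: k (1 : S^o).
  case: covf => _ _ supf; have [c Pc] := maxP nPt; move: y.
  apply: (superfluousP supf).
    split; first by exists 0; rewrite mul0r scale0r.
    move=> a _ _ [s ->] [u ->]; exists (a * s + u).
    by rewrite mulrDl scalerDl scalerA mulrA.
  move=> y; have [s ps] := surjp (f y).
  exists (s * c * t *: k (1 : S^o)); first by exists (s * c).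
  rewrite -kE fk -ps; apply/eqP; rewrite -subr_eq0 -linearB; apply/eqP/kerp.
  rewrite -opprB; apply: (submoduleN idealP).
  by rewrite -{1}[s]mulr1 -mulrA -mulrBr; apply: ideal_mull.
by have [s E] := genX (k (1 : S^o)); exists s; rewrite {1}E hZ.
Qed.

(** If nothing nonzero were killed by [P], one could start from the local
    element [e] and multiply by elements of [P] forever without reaching [0].
    By [product_annihilated] some [d] outside [P] kills such a product, and
    [d] is invertible on multiples of [e]. *)
Lemma perfect_socle : exists2 s, s != 0 & forall x, P x -> s * x = 0.
Proof.
have [e nPe locE] := local_element.
have [//|nsoc] := pselect (exists2 s, s != 0 & forall x, P x -> s * x = 0).
have /choice[c cP] : forall s, exists x, P x /\ (s != 0 -> s * x != 0).
  move=> s; have [->|s0] := eqVneq s 0; first by exists 0; case: idealP.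
  apply: contrapT => nx.
  case: nsoc; exists s => // x Px; apply/eqP/negPn/negP => sx.
  by case: nx; exists x.
pose s := fix s n := if n is m.+1 then s m * c (s m) else e.
have sn0 n : s n != 0.
  elim: n => [|n IHn] /=; last exact: (cP _).2.
  by apply/eqP => e0; apply: nPe; rewrite e0; case: idealP.
have [|n [d [Pd dE]]] := @product_annihilated (fun n => c (s n)).
  by move=> n; case: (cP (s n)).
have sE : s n = e * \prod_(i < n) c (s i).
  elim: n {d Pd dE} => [|n IHn]; first by rewrite big_ord0 mulr1.
  by rewrite big_ord_recr /= mulrA -IHn.
have nPd : ~ P d.
  by move=> Pd'; apply: P1; rewrite -(subrK d 1); apply: (submoduleD idealP).
have [u eE] := locE d nPd.
by case/eqP: (sn0 n); rewrite sE eE (mulrAC u) -!mulrA dE !mulr0.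
Qed.

End Socle.

(** * Maximal ideals and the socle of a quotient *)

(** Zorn's lemma in the form that serves both maximal ideals (avoid [1]) and
    maximal extensions of partial linear maps (avoid the pairs [(0, m)] with
    [m] nonzero). The last clause is maximality applied to [K + R x]. *)
Lemma maximal_submodule_avoiding (R : comNzRingType) (M : lmodType R)
    (D N : M -> Prop) :
  is_submodule N -> (forall x, N x -> ~ D x) ->
  exists K : M -> Prop, [/\ is_submodule K, forall x, N x -> K x,
    forall x, K x -> ~ D x &
    forall x, ~ K x -> exists a y, K y /\ D (y + a *: x)].
Proof.
move=> subN ND.
(* The empty set is good, as the union of the empty chain must be; any other
   good set contains N. *)
pose good (X : set M) := [/\ forall z, X z -> forall x, N x -> X x,
  forall a x y, X x -> X y -> X (a *: x + y) & forall x, X x -> ~ D x].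
have [|K [[KN Klin KD] maxK]] := @Zorn_bigcup M good.
  move=> F Fgood Ftot; split.
  - move=> z [X FX Xz] x Nx; exists X => //.
    by case: (Fgood X FX) => XN _ _; exact: XN _ Xz _ Nx.
  - move=> a x y [X FX Xx] [Y FY Yy].
    have [XY|YX] := Ftot X Y FX FY.
      exists Y => //; case: (Fgood Y FY) => _ Ylin _.
      by apply: Ylin => //; apply: XY.
    exists X => //; case: (Fgood X FX) => _ Xlin _.
    by apply: Xlin => //; apply: YX.
  - by move=> x [X FX Xx]; case: (Fgood X FX) => _ _; apply.
have N0 : N 0 by case: subN.
have K0 : K 0.
  have [[z /KN]|nK] := pselect (exists z, K z); first exact.
  case: (maxK N); last by split=> //; case: subN.
  by split=> [z Kz | NK]; [case: nK; exists z | apply: nK; exists 0; apply: NK].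
have subK : is_submodule K by split.
exists K; split=> // [|x nKx]; first exact: KN _ K0.
pose K' y := exists a z, K z /\ y = z + a *: x.
have K'x : K' x by exists 1, 0; rewrite add0r scale1r.
apply: contrapT => nD; apply: (maxK K').
  by split=> [y Ky | K'K]; [exists 0, y; rewrite scale0r addr0 | apply/nKx/K'K].
split.
- move=> _ _ y Ny; exists 0, y; rewrite scale0r addr0; split=> //.
  exact: KN _ K0 _ Ny.
- move=> a _ _ [b [y [Ky ->]]] [c [z [Kz ->]]].
  exists (a * b + c), (a *: y + z); split; first exact: Klin.
  by rewrite scalerDr scalerDl scalerA addrACA.
- by move=> _ [a [y [Ky ->]]] Dy; apply: nD; exists a, y.
Qed.

Definition maximal_ideal (R : comNzRingType) (P : R^o -> Prop) : Prop :=
  [/\ is_submodule P, ~ P 1 & forall t, ~ P t -> exists c, P (1 - c * t)].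

Lemma exists_maximal_ideal (R : comNzRingType) (I : R^o -> Prop) :
  is_submodule I -> ~ I 1 ->
  exists2 P : R^o -> Prop, maximal_ideal P & forall x, I x -> P x.
Proof.
move=> subI I1; have [|P [subP IP P1 maxP]] :=
  @maximal_submodule_avoiding R R^o (fun x => x = 1) I subI.
  by move=> x Ix x1; apply: I1; rewrite -x1.
exists P => //; split=> // [/P1|t /maxP[c [y [Py yE]]]]; first exact.
by exists c; rewrite -yE addrK.
Qed.

Lemma idealr_exists (R : comNzRingType) (I : R^o -> Prop) :
  is_submodule I -> ~ I 1 -> exists J : idealr R, forall x, x \in J <-> I x.
Proof.
move=> subI I1; pose p : R -> bool := fun x => `[< I x >].
have pE x : (x \in (p : {pred R})) <-> I x by split=> /asboolP.
have clp : idealr_closed (p : {pred R}).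
  split; first by apply/pE; case: subI.
    by apply/negP => /pE.
  by move=> a u v /pE Iu /pE Iv; apply/pE; case: subI => _; apply.
pose J : idealr R := HB.pack p (isIdealr.Build R p clp).
by exists J.
Qed.

(** The simple module [R / P] embeds in [R / I]: [perfect_socle] for the perfect
    ring [R / I], read back in [R]. *)
Lemma almost_perfect_socle (R : idomainType) (I P : R^o -> Prop) :
  almost_perfect R -> is_submodule I -> (exists2 r, I r & r != 0) ->
  maximal_ideal P -> (forall x, I x -> P x) ->
  exists2 s : R, ~ I s & forall x, P x -> I (s * x).
Proof.
move=> hR subI [r Ir r0] [subP P1 maxP] IP.
have [|J JE] := idealr_exists subI; first by move/IP.
have perfS : perfect_ring {ideal_quot J} by apply: hR; exists r => //; apply/JE.
pose pi : {rmorphism R -> {ideal_quot J}} := \pi_{ideal_quot J}%qT.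
pose P' (u : {ideal_quot J}) := P (repr u).
have piP x : pi x = 0 <-> I x.
  rewrite -JE -[x in x \in _]subr0 Quotient.idealrBE -(rmorph0 pi).
  by split=> /eqP.
have P'pi x : P' (pi x) <-> P x.
  have PB : P (repr (pi x) - x).
    by apply/IP/piP; rewrite rmorphB /= /pi reprK subrr.
  split=> Px; first by rewrite -(subKr (repr (pi x)) x); apply: (submoduleB subP).
  by rewrite /P' -(subrK x (repr (pi x))); apply: (submoduleD subP).
have surjpi u : exists x, u = pi x by exists (repr u); rewrite /pi /= reprK.
have idealP' : is_submodule (P' : {ideal_quot J}^o -> Prop).
  split; first by rewrite -(rmorph0 pi); apply/P'pi; case: subP.
  move=> a x y; have [[[b ->] [v ->]] [w ->]] := (surjpi a, surjpi x, surjpi y).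
  move=> /P'pi Pv /P'pi Pw; rewrite /GRing.scale /= -rmorphM -rmorphD.
  by apply/P'pi; case: subP => _; apply.
have [|t|u u0 uP] := perfect_socle idealP' perfS.
- by rewrite -(rmorph1 pi) => /P'pi.
- have [x ->] := surjpi t => nPx.
  have [|c Pc] := maxP x; first by move/P'pi.
  by exists (pi c); rewrite -(rmorph1 pi) -rmorphM -rmorphB; apply/P'pi.
have [s sE] := surjpi u; exists s => [/piP s0 | x Px].
  by rewrite sE s0 eqxx in u0.
by apply/piP; rewrite rmorphM /= -/pi -sE uP //; apply/P'pi.
Qed.

(** * Extension of partial linear maps *)
Section PartialMaps.
Variables (R : comNzRingType).

(** A linear map defined on a submodule of [B], encoded by its graph. *)
Definition partial_map (B M : lmodType R) (G : B * M -> Prop) : Prop :=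
  is_submodule G /\ forall m, G (0, m) -> m = 0.

Lemma partial_map_fun (B M : lmodType R) (G : B * M -> Prop) b m n :
  partial_map G -> G (b, m) -> G (b, n) -> m = n.
Proof.
move=> [subG funG] Gm Gn; apply/eqP; rewrite -subr_eq0; apply/eqP/funG.
have := submoduleB subG Gm Gn.
by rewrite [X in G X](_ : _ = (b - b, m - n)) // subrr.
Qed.

(** The graph is itself a module, which embeds in [B] by the first projection;
    injectivity of [E] extends the second projection along it. *)
Lemma injective_extension (B E : lmodType R) (G : B * E -> Prop) :
  injective_module E -> partial_map G ->
  exists g : {linear B -> E}, forall b m, G (b, m) -> g b = m.
Proof.
move=> injE Gpart; have [A [i [inji GE]]] := submodule_exists (proj1 Gpart).
have [|j jE] := @linear_exists _ A B (fun a => (i a).1).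
  by move=> c x y; rewrite linearP.
have [|f fE] := @linear_exists _ A E (fun a => (i a).2).
  by move=> c x y; rewrite linearP.
have [|g gE] := injE _ _ j f.
  move=> x y; rewrite !jE => xy; apply: inji.
  have [Gx Gy] : G (i x) /\ G (i y) by split; apply/GE; eexists.
  move: xy Gx Gy; case: (i x) (i y) => [b m] [b' m'] /= <- Gx Gy.
  by rewrite (partial_map_fun Gpart Gx Gy).
exists g => b m /GE[a aE].
by have := gE a; rewrite jE fE aE.
Qed.

(** By Zorn's lemma it is enough to extend a partial map by one new element
    [y]; the value [m] at [y] only has to agree with [G] on the multiples of
    [y] that already lie in the domain. *)
Lemma injective_of_extensions (M : lmodType R) :
  (forall (B : lmodType R) (G : B * M -> Prop) (b : B),
     partial_map G -> (forall m, ~ G (b, m)) ->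
     exists y m, (forall n, ~ G (y, n)) /\
                 (forall r n, G (r *: y, n) -> n = r *: m)) ->
  injective_module M.
Proof.
move=> ext A B i f inji.
have [||G [subG G0 GD maxG]] := @maximal_submodule_avoiding R (B * M)%type
    (fun z => z.1 = 0 /\ z.2 != 0) (fun z => exists a, z = (i a, f a)).
- split; first by exists 0; rewrite !linear0.
  by move=> c _ _ [x ->] [y ->]; exists (c *: x + y); rewrite !linearP.
- move=> _ [a ->] /= [ia0]; suff -> : a = 0 by rewrite linear0 eqxx.
  by apply: inji; rewrite ia0 linear0.
have partG : partial_map G.
  by split=> // m /GD /= nD; apply/eqP/negPn/negP => m0; apply: nD.
have totG b : exists m, G (b, m).
  apply: contrapT => nG.
  have [|y [m [nGy ym]]] := ext B G b partG.
    by move=> m Gm; apply: nG; exists m.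
  have [a [[b' n] [Gn /= [b'E]]]] := maxG _ (nGy m).
  have {}b'E : b' = - a *: y by rewrite scaleNr; apply/eqP; rewrite -addr_eq0 b'E.
  by rewrite b'E in Gn; rewrite (ym _ _ Gn) scaleNr addNr eqxx.
have [g gE] := choice totG.
have [|h hE] := @linear_exists _ B M g.
  move=> c x y; apply: (partial_map_fun partG (gE _)).
  by case: subG => _ /(_ c (x, g x) (y, g y)); apply.
exists h => a; rewrite hE; apply: (partial_map_fun partG (gE _)).
by apply: G0; exists a.
Qed.

Lemma colon_submodule (B M : lmodType R) (G : B * M -> Prop) y :
  partial_map G -> is_submodule (fun r : R^o => exists m, G (r *: y, m)).
Proof.
move=> [[G0 Glin] _]; split; first by exists 0; rewrite scale0r.
move=> a r s [m Gm] [n Gn]; exists (a *: m + n).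
have := Glin a _ _ Gm Gn.
rewrite [X in G X -> _](_ : _ = ((a * r + s) *: y, a *: m + n)) //.
by rewrite scalerDl -scalerA.
Qed.

(** Since [R / P] embeds in [R / rR] by [1 |-> s], a map from [R / P] to the
    injective module [E], given by the image [u] of [1], extends to [R / rR];
    [v] is the image of [1] under the extension. *)
Lemma lift_simple_socle (E : lmodType R) (P : R^o -> Prop) (r s : R) (u : E) :
  injective_module E -> maximal_ideal P ->
  (forall t, s != r * t) -> (forall p, P p -> exists t, s * p = r * t) ->
  (forall p, P p -> p *: u = 0) ->
  exists2 v : E, r *: v = 0 & s *: v = u.
Proof.
move=> injE [subP P1 maxP] sr sP Pu.
pose G (z : R^o * E) := exists a b : R, z = (s * a + r * b, a *: u).
have [|g gE] := @injective_extension R^o E G injE.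
  split.
    split; first by exists 0, 0; rewrite !mulr0 addr0 scale0r.
    move=> c _ _ [a [b ->]] [a' [b' ->]]; exists (c * a + a'), (c * b + b').
    rewrite scalerDl -scalerA !mulrDr [s * (c * a)]mulrCA [r * (c * b)]mulrCA.
    by rewrite addrACA -mulrDr.
  (* If a were outside P, it would be invertible modulo P, and s would be a
     multiple of r. *)
  move=> m [a [b [abE ->]]]; apply: Pu; apply: contrapT => /maxP[c /sP[t tE]].
  case/eqP: (sr (t - c * b)); rewrite mulrBr -tE mulrBr mulr1 -addrA.
  rewrite -[s in LHS]addr0 -opprD; congr (_ + _); apply/esym/eqP.
  rewrite oppr_eq0 [s * _]mulrCA [r * _]mulrCA -mulrDr.
  by rewrite -abE mulr0.
have gZ (x : R) : x *: g (1 : R^o) = g x.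
  by rewrite -linearZ /= /GRing.scale /= mulr1.
exists (g (1 : R^o)); rewrite gZ; apply: gE.
- by exists 0, 1; rewrite mulr0 add0r mulr1 scale0r.
- by exists 1, 0; rewrite mulr0 addr0 mulr1 scale1r.
Qed.

End PartialMaps.

(** * Divisible modules of injective dimension at most one *)
Section AlmostPerfect.
Variable R : idomainType.
Hypothesis apR : almost_perfect R.

(** A sharpening of Baer's criterion: only maximal ideals need testing. For an
    element [b] outside the domain of a partial map, let [I] be the ideal that
    sends [b] into the domain. If [I] is zero, any value at [b] will do.
    Otherwise a simple submodule of [R / I] yields a multiple [s *: b], still
    outside, that exactly a maximal ideal sends into the domain. *)
Lemma injective_of_maximal_ideals (M : lmodType R) :
  (forall (P : R^o -> Prop) (G : R^o * M -> Prop),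
     maximal_ideal P -> (exists2 r, P r & r != 0) -> partial_map G ->
     (forall r, P r <-> exists m, G (r, m)) ->
     exists m, forall r n, G (r, n) -> n = r *: m) ->
  injective_module M.
Proof.
move=> ext; apply: injective_of_extensions => B G b partG nGb.
pose I (r : R^o) := exists m, G (r *: b, m).
have subI : is_submodule I by apply: colon_submodule.
have [I0|nI0] := pselect (forall r, I r -> r = 0).
  exists b, 0; split=> // r n Gn; rewrite scaler0.
  have r0 : r = 0 by apply: I0; exists n.
  by rewrite r0 scale0r in Gn; apply: (proj2 partG).
have exI : exists2 r, I r & r != 0.
  apply: contrapT => nex; apply: nI0 => r Ir.
  by apply/eqP/negPn/negP => r0; apply: nex; exists r.
have I1 : ~ I 1 by case=> m; rewrite scale1r; apply: nGb.
have [P maxP IP] := exists_maximal_ideal subI I1.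
have [s nIs sP] := almost_perfect_socle apR subI exI maxP IP.
have nGy n : ~ G (s *: b, n) by move=> Gn; apply: nIs; exists n.
pose H (z : R^o * M) := G (z.1 *: (s *: b), z.2).
have [|||m mE] := ext P H maxP.
- by case: exI => r /IP Pr r0; exists r.
- case: partG => -[G0 Glin] funG; split=> [|m]; last by rewrite /H scale0r => /funG.
  split=> [|a x y Hx Hy]; first by rewrite /H scale0r.
  have := Glin a _ _ Hx Hy; rewrite /H.
  rewrite [X in G X -> _](_ : _ = ((a * x.1 + y.1) *: (s *: b), a *: x.2 + y.2)) //.
  by rewrite scalerDl -scalerA.
- move=> r; split=> [/sP[m]|[m Hm]].
    by exists m; rewrite /H /= scalerA mulrC.
  apply: contrapT => nPr; case: maxP => _ _ /(_ r nPr)[c /sP Isc]; apply: nIs.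
  have Isr : I (s * r) by exists m; rewrite mulrC -scalerA.
  suff -> : s = c * (s * r) + s * (1 - c * r) by case: subI => _; apply.
  by rewrite mulrBr mulr1 addrC mulrCA subrK.
by exists (s *: b), m; split=> // r n Gn; apply: mE.
Qed.

(** In homological terms: [Ext^1(R/rR, M) = 0] by divisibility, and the
    vanishing passes to the submodule [R / P] of [R / rR] because
    [Ext^2(-, M) = 0]. Concretely, extend [G : P -> M] to [R -> E0], with [1]
    sent to [e]. Then [P] kills [d e], so [d e] is the image of an element [v]
    killed by [r]; divisibility provides a lift [w] of [v] to [E0] that is
    also killed by [r], and [e - s *: w] comes from the sought element of
    [M]. *)
Lemma injective_of_resolution (M E0 E1 : lmodType R)
    (i : {linear M -> E0}) (d : {linear E0 -> E1}) :
  divisible M -> injective_module E0 -> injective_module E1 -> injective i ->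
  (forall x, d x = 0 <-> exists m, i m = x) -> surjective_map d ->
  injective_module M.
Proof.
move=> divM injE0 injE1 inji kerd surjd.
apply: injective_of_maximal_ideals => P G maxP [r Pr r0] partG domG.
have [subP _ _] := maxP.
pose G0 (z : R^o * E0) := exists2 m, G (z.1, m) & z.2 = i m.
have [|g gE] := @injective_extension R R^o E0 G0 injE0.
  case: partG => -[G00 Glin] funG; split; last first.
    by move=> _ [m /= /funG -> ->]; rewrite linear0.
  split; first by exists 0 => //=; rewrite linear0.
  move=> a [x _] [y _] [m /= Gm ->] [n /= Gn ->].
  by exists (a *: m + n); [exact: (Glin a _ _ Gm Gn) | rewrite [RHS]linearP].
pose e := g (1 : R^o).
have eE (p : R) m : G (p, m) -> p *: e = i m.
  move=> Gm; rewrite /e -linearZ /= /GRing.scale /= mulr1; apply: gE.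
  by exists m.
have [s nIs sP] : exists2 s, ~ (exists t, s = r * t)
    & forall p : R, P p -> exists t, s * p = r * t.
  apply: (@almost_perfect_socle R (fun x => exists t, x = r * t) P apR) => //.
  - split; first by exists 0; rewrite mulr0.
    move=> a _ _ [x ->] [y ->]; exists (a * x + y).
    by rewrite mulrDr [r * (a * x)]mulrCA.
  - by exists r => //; exists 1; rewrite mulr1.
  - by move=> _ [t ->]; rewrite mulrC; apply: (submoduleZ subP).
have [|||v rv sv] := @lift_simple_socle R E1 P r s (d e) injE1 maxP.
- by move=> t; apply/eqP => st; apply: nIs; exists t.
- exact: sP.
- by move=> p /domG[m /eE pe]; rewrite -linearZ /= pe; apply/kerd; exists m.
have [w0 dw0] := surjd v.
have [m0 m0E] : exists m, i m = r *: w0 by apply/kerd; rewrite linearZ /= dw0.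
have [n nE] := divM r r0 m0.
pose w := w0 - i n.
have rw : r *: w = 0 by rewrite scalerBr -linearZ /= nE m0E subrr.
have dw : d w = v.
  rewrite linearB /= dw0 [d (i n)](_ : _ = 0) ?subr0 //.
  by apply/kerd; exists n.
have [m mE] : exists m, i m = e - s *: w.
  by apply/kerd; rewrite linearB linearZ /= dw sv subrr.
exists m => p n' Gn'; apply: inji; rewrite linearZ /= mE -(eE _ _ Gn') scalerBr.
have [|t tE] := sP p; first by apply/domG; exists n'.
by rewrite scalerA mulrC tE mulrC -scalerA rw scaler0 subr0.
Qed.

End AlmostPerfect.

Lemma injective_divisible (R : idomainType) (M : lmodType R) :
  injective_module M -> divisible M.
Proof.
move=> injM r r0 m.
have [|j jE] := @linear_exists _ R^o R^o (fun x : R => x * r).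
  by move=> a x y; rewrite mulrDl -mulrA.
have [|f fE] := @linear_exists _ R^o M (fun x : R => x *: m).
  by move=> a x y; rewrite scalerDl -scalerA.
have [|g gE] := injM _ _ j f; first by move=> x y; rewrite !jE => /(mulIf r0).
exists (g (1 : R^o)); rewrite -linearZ /= /GRing.scale /= mulr1.
by have := gE 1; rewrite jE fE mul1r scale1r.
Qed.

(** The resolution is [0 -> M -> M -> 0 -> ...]. *)
Lemma injective_injdim_le (R : comNzRingType) (M : lmodType R) (n : nat) :
  injective_module M -> injdim_le n M.
Proof.
move=> injM; pose Z : lmodType R := 'rV[R]_0.
have Z0 (x : Z) : x = 0 by apply/rowP => -[].
pose E (i : nat) : lmodType R := if i is 0 then M else Z.
exists E, (idfun : {linear M -> M}), (fun i => \0 : {linear E i -> E i.+1}).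
split=> //=.
- case=> // i A B j f _; exists (\0 : {linear B -> Z}) => a /=.
  by rewrite [RHS]Z0.
- by move=> x; split=> // _; exists x.
- by move=> i x; split=> // _; exists 0; rewrite [RHS]Z0.
- by case.
Qed.

Theorem proposition3p1 (R : idomainType) (hR : almost_perfect R)
  (hQ : ~ surjective_map (@tofrac R : R -> {fraction R})) (M : lmodType R) :
  injective_module M <-> divisible M /\ injdim_le 1 M.
Proof.
split=> [injM | [divM [E [e [d [injE inje ker0 ker1 E0]]]]]].
  by split; [apply: injective_divisible | apply: injective_injdim_le].
apply: (@injective_of_resolution R hR M _ _ e (d 0%N)) => // x.
by apply/ker1; rewrite [LHS]E0.
Qed.
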